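(* Let $F$ be a local field of characteristic zero, let $V$ be a finite-dimensional $F$-vector space with $\dim_F V\ge 2$, let $Q$ be a non-degenerate quadratic form on $V$, and let $\mathsf{QG}_{\mathcal{Q}}$ be the quadratic graph of the quadratic space $\mathcal{Q}=(V,Q)$. Then the Borel chromatic number $\chi_{\mathrm{Bor}}(\mathsf{QG}_{\mathcal{Q}})$ is finite if and only if $Q$ is anisotropic over $F$.
   Context: A local field is a topological field whose topology is non-discrete and locally compact; a local field of characteristic zero is isomorphic to $\mathbb{R}$, $\mathbb{C}$, or a finite extension of $\mathbb{Q}_p$ for a prime $p$. A finite-dimensional $F$-vector space $V$ carries its usual topology (that of $F^n$ via any choice of basis). A quadratic form on $V$ is a function $Q:V\to F$ with $Q(ax)=a^2Q(x)$ for $a\in F$, $x\in V$, such that $(x,y)\mapsto Q(x+y)-Q(x)-Q(y)$ is bilinear; it is non-degenerate if the symmetric bilinear form $\langle x,y\rangle=\frac12(Q(x+y)-Q(x)-Q(y))$ is non-degenerate. $Q$ is isotropic if there is a non-zero $v\in V$ with $Q(v)=0$, and anisotropic otherwise. The quadratic graph $\mathsf{QG}_{\mathcal{Q}}$ of $\mathcal{Q}=(V,Q)$ has vertex set $V$, and $v,w\in V$ are adjacent if and only if $Q(v-w)=1$. For a graph $\mathcal{G}$ whose vertex set is a topological space, the Borel chromatic number $\chi_{\mathrm{Bor}}(\mathcal{G})$ is the least cardinal $c$ such that the vertex set can be partitioned into $c$ Borel subsets none of which contains two adjacent vertices. *)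

(* Defs.v *)
From HB Require Import structures.
From mathcomp Require Import all_boot all_order all_algebra.
From mathcomp Require Import all_classical topology tvs measurable_structure.

Set Implicit Arguments.
Unset Strict Implicit.
Unset Printing Implicit Defensive.

Import GRing.Theory passmx.

Local Open Scope classical_set_scope.
Local Open Scope ring_scope.

HB.mixin Record TopologicalZmodule_isTopologicalField F
    & TopologicalZmodule F & GRing.Field F := {
  field_mul_continuous : continuous (fun x : F * F => x.1 * x.2) ;
  field_inv_continuous : forall x : F, x != 0 -> {for x, continuous (@GRing.inv F)}
}.

#[short(type="topologicalFieldType")]
HB.structure Definition TopologicalField :=
  {F of TopologicalZmodule F & GRing.Field F
        & TopologicalZmodule_isTopologicalField F}.

(* Topological fields are Hausdorff by convention; without this clause the
   indiscrete topology would qualify as non-discrete and locally compact. *)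
Record local_field (F : topologicalFieldType) : Prop := LocalField {
  local_field_hausdorff : hausdorff_space F ;
  local_field_nondiscrete : ~ (forall x : F, open [set x]) ;
  local_field_locally_compact : locally_compact [set: F]
}.

(* V with the topology transported from F^n by the coordinates in a basis;
   usual_space_basis shows that the choice of basis is immaterial. *)
Definition usual_space (F : topologicalFieldType) (V : vectType F) :=
  initial_topology (rVof (vbasis {:V})).

HB.instance Definition _ (F : topologicalFieldType) (V : vectType F) :=
  Topological.on (usual_space V).

Section BasisIndependence.
Variables (F : topologicalFieldType) (V : vectType F).

Let mulmx_continuous m n (M : 'M[F]_(m, n)) :
  continuous (fun r : 'rV[F]_m => r *m M).
Proof.
have coord i j : continuous (fun r : 'rV[F]_m => r i j).
  move=> r A nA; exists (fun i' j' => [set x | i' = i -> j' = j -> A x]).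
    move=> i' j'; case: (pselect (i' = i /\ j' = j)) => [[-> ->]|ne].
      by apply: filterS nA => x Ax.
    by apply: filterS filterT => x _ ? ?; case: ne.
  by move=> s /(_ i j); exact.
have sumc I (s : seq I) (f : I -> 'rV[F]_m -> F) :
    (forall i, continuous (f i)) -> continuous (fun r => \sum_(i <- s) f i r).
  move=> fc; elim: s => [|i s IH].
    have -> : (fun r => \sum_(i <- [::]) f i r) = cst 0.
      by apply/funext => r; rewrite big_nil.
    exact: cst_continuous.
  have -> : (fun r => \sum_(j <- i :: s) f j r) =
            (fun r => f i r + \sum_(j <- s) f j r).
    by apply/funext => r; rewrite big_cons.
  move=> r; apply: (@continuous2_cvg _ _ _ _ _ (nbhs_filter r) (f i)
      (fun x => \sum_(j <- s) f j x) (fun x y : F => x + y) (f i r)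
      (\sum_(j <- s) f j r)).
  - exact: (@add_continuous F (f i r, \sum_(j <- s) f j r)).
  - exact: fc.
  - exact: IH.
have entry j : continuous (fun r : 'rV[F]_m => (r *m M) 0 j).
  have -> : (fun r : 'rV[F]_m => (r *m M) 0 j) =
            (fun r => \sum_i r 0 i * M i j).
    by apply/funext => r; rewrite mxE.
  apply: sumc => i r.
  apply: (@continuous2_cvg _ _ _ _ _ (nbhs_filter r) (fun x : 'rV[F]_m => x 0 i)
      (cst (M i j)) (fun x y : F => x * y) (r 0 i) (M i j)).
  - exact: (@field_mul_continuous F (r 0 i, M i j)).
  - exact: coord.
  - exact: (@cst_continuous _ _ (M i j) r).
move=> r A [P nP PA].
have nr : \forall s \near r, forall j, P 0 j ((s *m M) 0 j).
  apply: (@filter_forall _ _ (fun j s => P 0 j ((s *m M) 0 j)) _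
    (nbhs_filter r)) => j.
  exact: (entry j r _ (nP 0 j)).
apply: filterS nr => s Ps; apply: PA => i j.
by rewrite (ord1 i); exact: Ps.
Qed.

Let open_basis (e e' : (\dim {:V}).-tuple V) (A : set V) :
  basis_of {:V} e' -> open (A : set (initial_topology (rVof e))) ->
  open (A : set (initial_topology (rVof e'))).
Proof.
move=> e'_basis [U Uo <-].
pose M := lin1_mx (rVof e \o vecof e').
exists ((fun r => r *m M) @^-1` U).
  by move/continuousP: (@mulmx_continuous _ _ M); apply.
by apply/seteqP; split=> v /=; rewrite mul_rV_lin1 /= rVofK.
Qed.

Lemma usual_space_basis (e : (\dim {:V}).-tuple V) (A : set V) :
  basis_of {:V} e ->
  open (A : set (usual_space V)) <-> open (A : set (initial_topology (rVof e))).
Proof.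
by move=> e_basis; split; apply: open_basis => //; exact: vbasisP.
Qed.

End BasisIndependence.

Section QuadraticForms.
Variables (F : fieldType) (V : vectType F).
Implicit Type Q : V -> F.

Record quadratic_form Q : Prop := QuadraticForm {
  quadratic_formZ : forall (a : F) (x : V), Q (a *: x) = a ^+ 2 * Q x ;
  quadratic_form_linearl : forall y : V, scalar (fun x => Q (x + y) - Q x - Q y) ;
  quadratic_form_linearr : forall x : V, scalar (fun y => Q (x + y) - Q x - Q y)
}.

Definition associated_form Q (x y : V) : F :=
  2%:R^-1 * (Q (x + y) - Q x - Q y).

Definition nondegenerate_form Q : Prop :=
  forall x : V, (forall y : V, associated_form Q x y = 0) -> x = 0.

Definition isotropic Q : Prop := exists2 v : V, v != 0 & Q v = 0.

Definition anisotropic Q : Prop := ~ isotropic Q.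

Definition quadratic_graph Q (v w : V) : Prop := Q (v - w) = 1.

End QuadraticForms.

Section BorelChromaticNumber.
Variables (T : topologicalType) (adj : T -> T -> Prop).

Definition borel_set (A : set T) : Prop := <<s open >> A.

Definition independent_set (A : set T) : Prop :=
  forall v w, A v -> A w -> ~ adj v w.

Definition borel_coloring (P : set (set T)) : Prop :=
  partition P id [set: T] /\
  (forall A, P A -> borel_set A /\ independent_set A).

(* "The Borel chromatic number is the cardinal of C": cardinals are represented
   by sets up to equipotence, and the number is finite when C can be `I_n. *)
Definition borel_chromatic_number (I : Type) (C : set I) : Prop :=
  (exists2 P, borel_coloring P & (P #= C)%card) /\
  (forall P, borel_coloring P -> (C #<= P)%card).

End BorelChromaticNumber.

(* Main.v *)
Require Import Defs.
From HB Require Import structures.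
From mathcomp Require Import all_boot all_order all_algebra.
From mathcomp Require Import all_classical topology tvs measurable_structure.
From mathcomp Require Import ring.

Set Implicit Arguments.
Unset Strict Implicit.
Unset Printing Implicit Defensive.

Import GRing.Theory passmx.

Local Open Scope classical_set_scope.
Local Open Scope ring_scope.

(** Let S = {Q = 1}, so that the quadratic graph joins v and w when v - w is in
    S.  Both directions are about covering V by finitely many open independent
    sets.

    If Q is anisotropic, then S is compact: multiplication by a suitable a in F
    contracts V, so every v outside a compact neighbourhood C of 0 has a
    multiple a^n v in a compact shell around 0.  For v in S the value
    Q (a^n v) = a^(2n) then bounds n, since Q is bounded away from 0 on the
    shell (anisotropic_sphere_compact).  For any locally compact abelian group
    and any closed compact S avoiding 0, the graph is finitely coloured by open
    sets (compact_cayley_open_cover): cover the group by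
    translates e + U of a small neighbourhood, with centres e that are
    separated; compactness of S bounds how many other translates one of them
    can be joined to, so the centres split into finitely many classes inside
    which no two translates are joined.

    If Q is isotropic, let c be a Borel colouring with finitely many colours.
    Borel sets have the Baire property, so up to a meagre set the colour classes
    are open sets O_i; by the Baire category theorem these are independent and
    their union is dense (borel_coloring_dense_open).  Now V contains vectors
    u and w such that Q (t u + t^-1 w) = 1 for all t <> 0.  For large t the
    vector t u + t^-1 w is almost parallel to the line F u, so an open
    independent set meeting a line g + F u in g cannot meet it far away from g:
    otherwise one moves g by the small vector t^-1 w inside the open set.
    Points chosen further and further away along such a line therefore all have
    different colours, which exhausts any finite set of colours
    (isotropic_no_open_coloring). *)

(** * Continuity and separation in topological abelian groups *)

Lemma continuous_add (X : topologicalType) (T : topologicalZmodType)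
    (f g : X -> T) :
  continuous f -> continuous g -> continuous (fun x => f x + g x).
Proof.
move=> fc gc x; apply: (@continuous2_cvg _ _ _ _ _ (nbhs_filter x) f g +%R).
- exact: (@add_continuous T (f x, g x)).
- exact: fc.
- exact: gc.
Qed.

Lemma continuous_opp (X : topologicalType) (T : topologicalZmodType)
    (f : X -> T) :
  continuous f -> continuous (fun x => - f x).
Proof.
move=> fc x; apply: (@continuous_comp _ _ _ f (@GRing.opp T)); first exact: fc.
exact: (@opp_continuous T).
Qed.

Lemma continuous_sub (X : topologicalType) (T : topologicalZmodType)
    (f g : X -> T) :
  continuous f -> continuous g -> continuous (fun x => f x - g x).
Proof. by move=> fc gc; apply: continuous_add => //; exact: continuous_opp. Qed.

Lemma continuous_id (X : topologicalType) : continuous (fun x : X => x).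
Proof. by move=> x; exact: cvg_id. Qed.

Lemma continuous_shift (T : topologicalZmodType) (x : T) :
  continuous (fun z : T => z - x).
Proof.
by apply: continuous_sub; [exact: continuous_id|exact: cst_continuous].
Qed.

Lemma open_shift (T : topologicalZmodType) (x : T) (A : set T) :
  open A -> open [set z : T | A (z - x)].
Proof. by move: A; apply/continuousP/continuous_shift. Qed.

Lemma nbhs0_sub (T : topologicalZmodType) (U : set T) :
  nbhs (0 : T) U ->
  exists W : set T, [/\ open W, W 0 & forall x y : T, W x -> W y -> U (x - y)].
Proof.
move=> nU; have /= := @sub_continuous T (0 : T, 0 : T) U.
rewrite /nbhs /= subrr => /(_ nU) [[A B] /= [nA nB] AB].
exists ((A `&` B)°); split; first exact: open_interior.
  exact: filterI.
move=> x y /interior_subset[Ax _] /interior_subset[_ By].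
exact: (AB (x, y)).
Qed.

(** * Open colourings when the connection set is compact *)

Lemma maximal_disjoint_meets (I T : Type) (F : I -> set T) (A B : set I) x :
  maximal_disjoint_subcollection F A B -> B x -> F x !=set0 ->
  exists2 a, A a & F a `&` F x !=set0.
Proof.
move=> [AB tA maxA] Bx [z Fxz]; apply: contrapT => nmeet.
have nAx : ~ A x by move=> Ax; apply: nmeet; exists x => //; exists z.
have disj a : A a -> F a `&` F x !=set0 -> a = x.
  by move=> Aa ne; case: nmeet; exists a.
apply: (maxA (A `|` [set x])).
- split; first by move=> a Aa; left.
  by move=> /(_ x (or_intror erefl)).
- by move=> a [/AB //|->].
- move=> a b [Aa|->] [Ab|->] ne //; first exact: tA.
  + exact: disj.
  + by apply/esym; apply: disj => //; rewrite setIC.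
Qed.

(** Cover K by N translates d - W.  If x and y are both in p + (d - W), then
    d + p lies in both x + W and y + W, so disjointness gives x = y: each of the
    N translates accounts for at most one point.  The bound serves all centres
    p at once. *)
Lemma compact_separated (T : topologicalZmodType) (K W : set T) :
  compact K -> nbhs (0 : T) W ->
  exists N, forall (E : set T) (p : T) (s : seq T),
    trivIset E (fun e => [set z : T | W (z - e)]) -> uniq s ->
    {in s, forall x, E x /\ K (x - p)} -> (size s <= N)%N.
Proof.
move=> /compact_near_coveringP Kc nW.
have [D KD] : exists D : seq T,
    K `<=` [set x : T | exists2 d, d \in D & W (d - x)].
  (* The finite subcover is obtained along the filter of lists that contain a
     given list. *)
  pose sup (D0 : seq T) := [set D : seq T | {subset D0 <= D}].
  pose FF := filter_from setT sup.
  have FFilter : Filter FF.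
    apply: filter_from_filter; first by exists [::].
    move=> D1 D2 _ _; exists (D1 ++ D2) => // D sD.
    by split=> x xD; apply: sD; rewrite mem_cat xD ?orbT.
  have [|D0 _ cov] := Kc _ FF
      (fun (D : seq T) x => exists2 d, d \in D & W (d - x)) FFilter.
    move=> x Kx; exists ([set y : T | W (x - y)], sup [:: x]) => /=; last first.
      by move=> [y D] /= [Wy sD]; exists x => //; apply: sD; rewrite inE.
    split; last by exists [:: x].
    have : continuous (fun y : T => x - y).
      by apply: continuous_sub; [exact: cst_continuous|exact: continuous_id].
    by move=> /(_ x W); rewrite /= subrr; apply.
  by exists D0; apply: (cov D0).
exists (size D) => E p s tE us sE.
have /choice[f fP] : forall x : T, exists d : T,
    x \in s -> d \in D /\ W (d - (x - p)).
  move=> x; case xs : (x \in s); last by exists 0.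
  by have [_ /KD[d dD Wd]] := sE x xs; exists d.
rewrite -(size_map f); apply: uniq_leq_size.
  rewrite map_inj_in_uniq // => x y xs ys fxy.
  apply: tE; [exact: (sE x xs).1|exact: (sE y ys).1|].
  exists (f x + p); split=> /=.
    by have [_] := fP x xs; rewrite opprB addrA addrAC.
  by rewrite fxy; have [_] := fP y ys; rewrite opprB addrA addrAC.
by move=> _ /mapP[x xs ->]; exact: (fP x xs).1.
Qed.

Lemma compact_image2 (X Y Z : topologicalType) (f : X * Y -> Z) A B :
  continuous f -> compact A -> compact B -> compact (f @` (A `*` B)).
Proof.
move=> fc Ac Bc; apply: continuous_compact; last exact: compact_setX.
exact: continuous_subspaceT.
Qed.

Lemma locally_compact_nbhs (T : topologicalType) (x : T) :
  locally_compact [set: T] -> exists C, [/\ nbhs x C, compact C & closed C].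
Proof.
move=> /(_ x I)[C nC [Cc Ccl]]; exists C; split=> //.
by move: nC; rewrite /within /=; apply: filterS => y; apply.
Qed.

(** Any union of translates e + U is open, so there may be arbitrarily many
    centres e in each colour class.  The centres form a maximal set E0 with disjoint x + W; maximality makes the x + U cover because
    W - W is in U.  Splitting E0 is greedy colouring done with maximal sets:
    peel off a maximal subset whose translates of L are disjoint, then repeat
    on what remains.  L is large enough that joined translates of U have
    meeting translates of L, and a centre surviving n rounds has met n distinct
    peeled centres, all in a translate of the compact set L - L. *)
Theorem compact_cayley_open_cover (T : topologicalZmodType) (S : set T) :
  locally_compact [set: T] -> compact S -> closed S -> ~ S 0 ->
  exists N (A : 'I_N -> set T), [/\ forall i, open (A i),
    forall i x y, A i x -> A i y -> ~ S (x - y) & forall x, exists i, A i x].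
Proof.
move=> Tlc Sc Scl nS0.
have [C [nC Cc _]] := locally_compact_nbhs (0 : T) Tlc.
have [U [Uo U0 UC US]] : exists U : set T, [/\ open U, U 0, U `<=` C &
    forall x y : T, U x -> U y -> ~ S (x - y)].
  have [|U [Uo U0 US]] := @nbhs0_sub T (~` S).
    by apply: open_nbhs_nbhs; split=> //; exact: closed_openC.
  exists (U `&` C°); split; first by apply: openI => //; exact: open_interior.
  - by [].
  - by move=> x [_ /interior_subset].
  - by move=> x y [Ux _] [Uy _]; exact: US.
have [W [Wo W0 WU]] : exists W : set T, [/\ open W, W 0 &
    forall x y : T, W x -> W y -> U (x - y)].
  by apply: nbhs0_sub; exact: open_nbhs_nbhs.
pose L := C `|` (fun z : T * T => z.1 + z.2) @` (C `*` S).
have Lc : compact L.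
  by apply: compactU => //; apply: compact_image2 => //; exact: add_continuous.
have C0 : C 0 by exact: nbhs_singleton.
have L0 : L 0 by left.
pose K := (fun z : T * T => z.1 - z.2) @` (L `*` L).
have Kc : compact K by apply: compact_image2 => //; exact: sub_continuous.
have [|N boundN] := compact_separated Kc (W := W); first exact: open_nbhs_nbhs.
have [E0 E0max] :=
  ex_maximal_disjoint_subcollection (fun e => [set z : T | W (z - e)]) setT.
pose far (D : set T) :=
  sval (ex_maximal_disjoint_subcollection (fun e => [set z : T | L (z - e)]) D).
have farP D : maximal_disjoint_subcollection (fun e => [set z : T | L (z - e)])
    (far D) D.
  exact: svalP (ex_maximal_disjoint_subcollection _ D).
pose rest := fix rest n := if n is m.+1 then rest m `\` far (rest m) else E0.
(* Each round that leaves e behind supplies, by maximality, one more peeled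
   centre close to e. *)
have rest_close n e : rest n e -> exists s : seq T, [/\ uniq s, size s = n &
    {in s, forall x, [/\ E0 x, ~ rest n x & K (x - e)]}].
  elim: n => [|n IH]; first by exists [::].
  move=> [/= re nfe]; have [s [us ss sP]] := IH re.
  have [|e' fe' [z [/= Lz' Lz]]] := maximal_disjoint_meets (farP (rest n)) re.
    by exists e; rewrite /= subrr.
  have re' : rest n e' by have [+ _ _] := farP (rest n); exact.
  have subrest m : rest m `<=` E0.
    by elim: m => [//|m IHm] x [/IHm].
  exists (e' :: s); split=> [/=||x].
  - by rewrite us andbT; apply/negP => /sP[_ /(_ re')].
  - by rewrite /= ss.
  - rewrite inE => /predU1P[->|/sP[E0x nrx Kx]]; last first.
      by split=> // -[/nrx].
    split; first exact: subrest re'.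
      by move=> [_]; exact.
    by exists (z - e, z - e') => //=; rewrite opprB addrC addrA subrK.
have restN e : ~ rest N.+1 e.
  move=> /rest_close[s [us ss sP]]; suff : (size s <= N)%N by rewrite ss ltnn.
  apply: (boundN E0 e) => //; first by have [_ + _] := E0max.
  by move=> x /sP[].
exists N.+1, (fun i : 'I_N.+1 =>
  \bigcup_(e in far (rest i)) [set x : T | U (x - e)]).
split.
- by move=> i; apply: bigcup_open => e _; exact: open_shift.
- move=> i x y [e fe /= Ux] [e' fe' /= Uy] Sxy.
  (* x lies in e + L since U is in L, and in e' + L since C + S is in L. *)
  suff ee' : e = e'.
    apply: (US (x - e) (y - e)) => //; first by rewrite ee'.
    by rewrite opprB addrA subrK.
  have [_ tr _] := farP (rest i); apply: tr => //; exists x; split=> /=.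
    by left; exact: UC.
  right; exists (y - e', x - y); first by split=> //; exact: UC.
  by rewrite /= addrC addrA subrK.
- move=> x; have [||e E0e [z [/= Wze Wzx]]] :=
      maximal_disjoint_meets E0max (x := x) => //.
    by exists x; rewrite /= subrr.
  have Uxe : U (x - e).
    by have := WU _ _ Wze Wzx; rewrite opprB addrC addrA subrK.
  suff [i lti fi] : exists2 i, (i < N.+1)%N & far (rest i) e.
    by exists (Ordinal lti), e.
  apply: contrapT => nfar; apply: (restN e).
  have : (N.+1 <= N.+1)%N by [].
  elim: {1 3}(N.+1) => [//|n IH] ltn; split; first exact: IH (ltnW ltn).
  by move=> fe; apply: nfar; exists n.
Qed.

(** * Baire category and Borel colourings *)

Definition comeager (T : topologicalType) (R : set T) :=
  exists2 D : nat -> set T,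
    (forall n, open (D n) /\ dense (D n)) & \bigcap_n D n `<=` R.

Definition baire_property (T : topologicalType) (A : set T) :=
  exists2 O : set T, open O & comeager [set x | A x <-> O x].

Lemma comeagerS (T : topologicalType) (R R' : set T) :
  R `<=` R' -> comeager R -> comeager R'.
Proof. by move=> RR' [D Dod DR]; exists D => // x /DR /RR'. Qed.

Lemma open_dense_comeager (T : topologicalType) (R : set T) :
  open R -> dense R -> comeager R.
Proof. by move=> Ro Rd; exists (fun=> R) => // x /(_ 0%N I). Qed.

Lemma dense_setT (T : topologicalType) : dense [set: T].
Proof. by move=> O [x Ox] _; exists x. Qed.

Lemma comeagerT (T : topologicalType) : comeager [set: T].
Proof. by apply: open_dense_comeager; [exact: openT|exact: dense_setT]. Qed.

Lemma comeager_bigcap (T : topologicalType) (R : nat -> set T) :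
  (forall n, comeager (R n)) -> comeager (\bigcap_n R n).
Proof.
move=> Rc; have /choice[D DP] : forall n, exists D : nat -> set T,
    (forall m, open (D m) /\ dense (D m)) /\ \bigcap_m D m `<=` R n.
  by move=> n; have [D] := Rc n; exists D.
exists (fun k => if @unpickle (nat * nat)%type k is Some p then D p.1 p.2
                 else setT).
  move=> k; case: unpickle => [p|]; first exact: (DP p.1).1.
  by split; [exact: openT|exact: dense_setT].
move=> x Dx n _; apply: (DP n).2 => m _.
by have := Dx (pickle (n, m)) I; rewrite pickleK.
Qed.

Lemma comeagerI (T : topologicalType) (R R' : set T) :
  comeager R -> comeager R' -> comeager (R `&` R').
Proof.
move=> Rc R'c.
have /comeager_bigcap : forall n, comeager (if n is 0 then R else R') by case.
by apply: comeagerS => x Rx; split; [apply: (Rx 0%N)|apply: (Rx 1%N)].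
Qed.

Lemma comeager_shift (T : topologicalZmodType) (s : T) (R : set T) :
  comeager R -> comeager [set x : T | R (x - s)].
Proof.
move=> [D Dod DR]; exists (fun n => [set x : T | D n (x - s)]).
  move=> n; have [Do Dd] := Dod n; split; first exact: open_shift.
  move=> O [x Ox] Oo; have [||y [Oy Dy]] := Dd [set z : T | O (z - - s)].
  - by exists (x - s); rewrite /= opprK subrK.
  - exact: open_shift.
  - by exists (y + s); split; [move: Oy; rewrite /= opprK|rewrite /= addrK].
by move=> x Dx; apply: DR => n _; exact: (Dx n).
Qed.

Lemma nbhs_closure_sub (T : topologicalZmodType) (x : T) (O : set T) :
  open O -> O x ->
  exists G : set T, [/\ open G, G x & closure G `<=` O].
Proof.
move=> Oo Ox; have [|W [Wo W0 WO]] := @nbhs0_sub T [set z : T | O (z - - x)].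
  apply: open_nbhs_nbhs; split; first exact: open_shift.
  by rewrite /= opprK add0r.
exists [set z : T | W (z - x)]; split; first exact: open_shift.
  by rewrite /= subrr.
move=> y /= /(_ [set z : T | W (z - y)]).
have ny : nbhs y [set z : T | W (z - y)].
  by apply: open_nbhs_nbhs; split; [exact: open_shift|rewrite /= subrr].
move=> /(_ ny)[z [/= Wzx Wzy]].
have := WO _ _ Wzx Wzy.
by rewrite /= opprK opprB addrAC subrK addrC subrK.
Qed.

(** The Baire category theorem for locally compact groups: nested nonempty open
    sets G n, each with closure inside the previous one and inside D n, have a
    common point because they start inside a compact set. *)
Theorem comeager_dense (T : topologicalZmodType) (R : set T) :
  locally_compact [set: T] -> comeager R -> dense R.
Proof.
move=> Tlc [D Dod DR] O [x Ox] Oo.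
have [C [nC Cc Ccl]] := locally_compact_nbhs x Tlc.
pose good (G : set T) := open G /\ G !=set0.
(* The default setT is used only for sets that are not open or are empty. *)
have /choice[next nextP] : forall p : nat * set T, exists G',
    good p.2 -> good G' /\ closure G' `<=` p.2 `&` D p.1.
  move=> [n G] /=; have [[Go Gne]|?] := pselect (good G); last by exists setT.
  have [Do Dd] := Dod n; have [y [Gy Dy]] := Dd G Gne Go.
  have [||G' [G'o G'y clG']] := @nbhs_closure_sub T y (G `&` D n) => //.
    exact: openI.
  by exists G' => _; split=> //; split=> //; exists y.
pose G := fix G n := if n is m.+1 then next (m, G m) else O `&` C°.
have Ggood n : good (G n).
  elim: n => [|n IH]; last exact: (nextP (n, G n) IH).1.
  by split; [apply: openI => //; exact: open_interior|exists x].
have GS n : closure (G n.+1) `<=` G n `&` D n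
  by exact: (nextP (n, G n) (Ggood n)).2.
have Gle m n : (m <= n)%N -> G n `<=` G m.
  elim: n => [|n IH]; first by rewrite leqn0 => /eqP->.
  rewrite leq_eqVlt ltnS => /predU1P[->//|/IH]; apply: subset_trans => y Gy.
  by have [] := GS n y (subset_closure Gy).
pose FG := filter_from setT G.
have FGf : ProperFilter FG.
  apply: filter_from_proper; last by move=> n _; exact: (Ggood n).2.
  apply: filter_from_filter; first by exists 0%N.
  move=> m n _ _; exists (maxn m n) => // y Gy.
  by split; apply: Gle Gy; rewrite ?leq_maxl ?leq_maxr.
have [|p [_ clp]] := Cc FG FGf.
  by exists 0%N => // y /= [_ /interior_subset].
have Gp n : (G n `&` D n) p.
  by apply: GS => B nB; apply: clp => //; exists n.+1.
exists p; split; first exact: (Gp 0%N).1.1.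
by apply: DR => n _; exact: (Gp n).2.
Qed.

(** Sets that differ from an open set by a meagre set form a sigma-algebra.  For
    complements, ~` O is replaced by its interior, which loses only the nowhere
    dense boundary of O. *)
Lemma borel_baire_property (T : topologicalType) (A : set T) :
  borel_set A -> baire_property A.
Proof.
apply: smallest_sub; last first.
  by move=> O Oo; exists O => //; exact: comeagerS (@comeagerT T).
split.
- exists set0; first exact: open0; exact: comeagerS (@comeagerT T).
- move=> B [O Oo BO]; exists (~` O)°; first exact: open_interior.
  have : comeager (O `|` (~` O)°).
    apply: open_dense_comeager.
      by apply: openU => //; exact: open_interior.
    move=> O' O'ne O'o.
    have [[x [O'x Ox]]|disj] := pselect (O' `&` O !=set0).
      by exists x; split=> //; left.
    have [x O'x] := O'ne; exists x; split=> //; right.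
    rewrite /interior nbhsE; exists O' => // y O'y Oy.
    by apply: disj; exists y.
  move=> /(comeagerI BO); apply: comeagerS => x [/= BOx Ux]; split.
    by move=> [_ nBx]; case: Ux => // Ox; case: nBx; apply/BOx.
  by move=> /interior_subset nOx; split=> // /BOx.
- move=> B /(_ _) BB; have /choice[O OP] : forall n, exists O : set T,
      open O /\ comeager [set x | B n x <-> O x].
    by move=> n; have [O] := BB n; exists O.
  exists (\bigcup_n O n); first by apply: bigcup_open => n _; exact: (OP n).1.
  have /comeager_bigcap : forall n, comeager [set x | B n x <-> O n x].
    by move=> n; exact: (OP n).2.
  apply: comeagerS => x BO; split=> -[n _ nx]; exists n => //.
    by apply/(BO n I).
  by apply/(BO n I).
Qed.

(** If x and y = x - s were both in O i with s in S, then O i and its translate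
    by s would meet in a nonempty open set, and this set would contain a point z
    of the comeagre set where c and O agree both at z and at z - s: two joined
    points of colour i. *)
Theorem borel_coloring_dense_open (T : topologicalZmodType) (S : set T) N
    (c : T -> 'I_N) :
  locally_compact [set: T] ->
  (forall i, borel_set (c @^-1` [set i])) ->
  (forall x y : T, S (x - y) -> c x <> c y) ->
  exists O : 'I_N -> set T, [/\ forall i, open (O i),
    forall i (x y : T), O i x -> O i y -> ~ S (x - y) &
    dense (\bigcup_i O i)].
Proof.
move=> Tlc cB cS; have /choice[O OP] : forall i, exists O : set T,
    open O /\ comeager [set x | c x = i <-> O x].
  by move=> i; have [O] := borel_baire_property (cB i); exists O.
pose R := \bigcap_(i : 'I_N) [set x | c x = i <-> O i x].
have Rc : comeager R.
  have /comeager_bigcap : forall n, comeager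
      [set x | forall lt : (n < N)%N, c x = Ordinal lt <-> O (Ordinal lt) x].
    move=> n; have [lt|ge] := pselect (n < N)%N.
      have := (OP (Ordinal lt)).2; apply: comeagerS => x /= + lt'.
      by rewrite (bool_irrelevance lt' lt).
    by apply: comeagerS (@comeagerT T) => x _ lt; case: ge.
  by apply: comeagerS => x Rx [n lt] _; exact: (Rx n I lt).
exists O; split; first by move=> i; exact: (OP i).1.
- move=> i x y Ox Oy Sxy; pose s := x - y.
  have [||z [[Oz Ozs] [Rz Rzs]]] :=
    comeager_dense Tlc (comeagerI Rc (comeager_shift s Rc))
      (O := O i `&` [set z : T | O i (z - s)]).
  + by exists x; split=> //=; rewrite /s opprB addrC subrK.
  + by apply: openI; [|apply: open_shift]; exact: (OP i).1.
  + apply: (cS z (z - s)); first by rewrite opprB addrC subrK.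
    by transitivity i; [apply/(Rz i I)|apply/esym/(Rzs i I)].
- move=> G Gne Go; have [z [Gz Rz]] := comeager_dense Tlc Rc Gne Go.
  by exists z; split=> //; exists (c z) => //; apply/(Rz (c z) I).
Qed.

(** * The usual topology as a vector space topology *)

Section UsualSpace.
Context (F : topologicalFieldType) (V : vectType F).
Local Notation e := (vbasis {:V}).

Lemma continuous_coord (j : 'I_(\dim {:V})) :
  continuous (fun v : usual_space V => coord e j v : F).
Proof.
have cj : continuous (fun r : 'rV[F]_(\dim {:V}) => r 0 j).
  move=> r A nA; exists (fun _ j' => [set x | j' = j -> A x]).
    move=> i' j'; have [->|ne] := pselect (j' = j); rewrite ?(ord1 i').
      by apply: filterS nA => x Ax.
    by apply: filterS filterT => x _ /ne.
  by move=> s /(_ 0 j); exact.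
have -> : (fun v : usual_space V => coord e j v : F) =
    (fun r : 'rV[F]_(\dim {:V}) => r 0 j) \o (rVof e : usual_space V -> _).
  by apply/funext => v; rewrite /= -coord_rVof.
move=> v; apply: continuous_comp; last exact: cj.
exact: initial_continuous.
Qed.

(** The usual topology is the coarsest one with continuous coordinates; this is
    how continuity of the vector space operations is reduced to that of the
    operations of F. *)
Lemma continuous_usual_space (X : topologicalType) (f : X -> usual_space V) :
  (forall j, continuous (fun x => coord e j (f x) : F)) -> continuous f.
Proof.
move=> fc x A /= [B [[U Uo <-] /= Ufx UA]].
have : nbhs (rVof e (f x)) U by exact: open_nbhs_nbhs.
move=> [P nP PU].
have nr : \forall y \near x, forall j, P 0 j (rVof e (f y) 0 j).
  apply: (@filter_forall _ _ (fun j y => P 0 j (rVof e (f y) 0 j)) _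
    (nbhs_filter x)) => j.
  have := fc j x (P 0 j); rewrite /= /nbhs /= coord_rVof => /(_ (nP 0 j)).
  by apply: filterS => y /=; rewrite coord_rVof.
apply: filterS nr => y Py; apply: UA; apply: PU => i j.
by rewrite (ord1 i); exact: Py.
Qed.

HB.instance Definition _ := GRing.Lmodule.copy (usual_space V) V.

Lemma usual_space_add_continuous :
  continuous (fun x : usual_space V * usual_space V => x.1 + x.2).
Proof.
apply: continuous_usual_space => j.
rewrite (_ : (fun x => _) = (fun x : usual_space V * usual_space V =>
    coord e j x.1 + coord e j x.2)); last by apply/funext => x; rewrite linearD.
apply: continuous_add => x; apply: continuous_comp; try exact: continuous_coord.
  exact: cvg_fst.
exact: cvg_snd.
Qed.

HB.instance Definition _ :=
  PreTopologicalNmodule_isTopologicalNmodule.Build (usual_space V)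
    usual_space_add_continuous.

Lemma usual_space_opp_continuous :
  continuous (fun x : usual_space V => - x).
Proof.
apply: continuous_usual_space => j.
rewrite (_ : (fun x => _) = (fun x : usual_space V => - coord e j x)).
  by apply: continuous_opp; exact: continuous_coord.
by apply/funext => x; rewrite linearN.
Qed.

HB.instance Definition _ :=
  TopologicalNmodule_isTopologicalZmodule.Build (usual_space V)
    usual_space_opp_continuous.

End UsualSpace.

Lemma continuous_mul (X : topologicalType) (F : topologicalFieldType)
    (f g : X -> F) :
  continuous f -> continuous g -> continuous (fun x => f x * g x).
Proof.
move=> fc gc x; apply: (@continuous2_cvg _ _ _ _ _ (nbhs_filter x) f g *%R).
- exact: (@field_mul_continuous F (f x, g x)).
- exact: fc.
- exact: gc.
Qed.

Lemma continuous_scale (X : topologicalType) (F : topologicalFieldType)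
    (V : vectType F) (f : X -> F) (g : X -> usual_space V) :
  continuous f -> continuous g ->
  continuous (fun x => f x *: g x : usual_space V).
Proof.
move=> fc gc; apply: continuous_usual_space => j.
rewrite (_ : (fun x => _) = (fun x => f x * coord (vbasis {:V}) j (g x))).
  apply: continuous_mul => // x; apply: continuous_comp; first exact: gc.
  exact: continuous_coord.
by apply/funext => x; rewrite linearZ.
Qed.

Lemma continuous_sum (X : topologicalType) (T : topologicalZmodType)
    (I : Type) (s : seq I) (f : I -> X -> T) :
  (forall i, continuous (f i)) -> continuous (fun x => \sum_(i <- s) f i x).
Proof.
move=> fc; elim: s => [|i s IH].
  rewrite (_ : (fun _ => _) = cst 0); first exact: cst_continuous.
  by apply/funext => x; rewrite big_nil.
rewrite (_ : (fun _ => _) = (fun x => f i x + \sum_(j <- s) f j x)).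
  exact: continuous_add.
by apply/funext => x; rewrite big_cons.
Qed.


(** * Local fields *)

Section LocalField.
Context (F : topologicalFieldType) (F_local : local_field F).

Lemma local_field_closed1 (x : F) : closed [set x].
Proof.
apply: accessible_closed_set1; apply: hausdorff_accessible.
exact: local_field_hausdorff F_local.
Qed.

Lemma nbhs_neq (x y : F) : x != y -> \forall z \near x, z != y.
Proof.
move=> xy; apply: (@open_nbhs_nbhs _ x [set z : F | z != y]); split => //.
rewrite (_ : [set _ | _] = ~` [set y]).
  by apply: closed_openC; exact: local_field_closed1.
by apply/seteqP; split=> z /= /eqP.
Qed.

(** If 0 were isolated, then so would be every point, by translation. *)
Lemma nbhs0_neq0 (U : set F) : nbhs (0 : F) U -> exists2 a, a != 0 & U a.
Proof.
move=> nU; apply: contrapT => Usub.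
apply: (local_field_nondiscrete F_local) => x.
have U0 z : U z -> z = 0.
  by move=> Uz; apply: contrapT => /eqP z0; apply: Usub; exists z.
rewrite openE => _ ->.
have := @continuous_shift F x x U; rewrite /= subrr => /(_ nU) nx.
apply: (@filterS _ (nbhs x) _ (fun z => U (z - x))) nx => z /= /U0 /eqP.
by rewrite subr_eq0 => /eqP.
Qed.

(** This replaces an absolute value on F.  Let K be a compact neighbourhood of 0
    and x0 a nonzero point of K; for a close enough to 0, a K is contained in K
    and misses x0.  The sequence y n = a^n x0 stays in the compact set K, so it
    is enough that 0 is its only cluster point.  Near a cluster point b <> 0
    there would be y n and y m with n < m and x0 * y m / y n close to x0; but
    this quotient is a^(m-n) x0, which is in the closed set a K, and x0 is not.
    *)
Lemma exists_contracting :
  exists2 a : F, a != 0 & (fun n => a ^+ n) @ \oo --> (0 : F).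
Proof.
have hF := local_field_hausdorff F_local.
have [K [nK Kc Kcl]] :=
  locally_compact_nbhs (0 : F) (local_field_locally_compact F_local).
have [x0 x0N0 Kx0] := nbhs0_neq0 nK.
have /compact_near_coveringP Kcov := Kc.
have nW : \forall a \near (0 : F),
    K `<=` [set k : F | K (a * k) /\ a * k != x0].
  apply: (Kcov F (nbhs (0 : F)) (fun a k => K (a * k) /\ a * k != x0)
    (nbhs_filter _)) => k Kk.
  have /= := @field_mul_continuous F (0, k) [set z | K z /\ z != x0].
  rewrite /= mul0r => -[|[A A'] /= [nA nA'] AA'].
    by apply: filterI => //; apply: nbhs_neq; rewrite eq_sym.
  by exists (A', A) => // -[z a] /= [? ?]; exact: (AA' (a, z)).
have [a aN0 aK] := nbhs0_neq0 nW.
have Kax n : K (a ^+ n * x0).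
  elim: n => [|n IH]; rewrite ?expr0 ?mul1r // exprS -mulrA.
  exact: (aK _ IH).1.
pose y n := a ^+ n * x0.
have ycl b : cluster (y @ \oo) b -> b = 0.
  move=> clb; apply: contrapT => /eqP bN0.
  have clo : closed [set z | K (a^-1 * z)].
    apply: (@preimage_closed _ _ (fun z => a^-1 * z) K) => // z _.
    apply: continuous_mul; [exact: cst_continuous|exact: continuous_id].
  have nx0 : nbhs x0 (~` [set z | K (a^-1 * z)]).
    apply: open_nbhs_nbhs; split; first exact: closed_openC.
    by move=> /aK[_]; rewrite mulrA divff // mul1r eqxx.
  have qc : {for (b, b), continuous (fun p : F * F => x0 * p.2 * p.1^-1)}.
    apply: (@continuous2_cvg _ _ _ _ _ (nbhs_filter (b, b))
      (fun p : F * F => x0 * p.2) (fun p : F * F => p.1^-1) *%R).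
    - exact: (@field_mul_continuous F (x0 * b, b^-1)).
    - by apply: continuous_mul => p; [exact: cvg_cst|exact: cvg_snd].
    - apply: (@continuous_comp _ _ _ fst (@GRing.inv F)); first exact: cvg_fst.
      exact: field_inv_continuous.
  have := qc (~` [set z | K (a^-1 * z)]).
  rewrite /= mulfK // => /(_ nx0) [[A A'] /= [nA nA'] AA'].
  have nAA : nbhs b (A `&` A') by exact: filterI.
  have [_ [[n _ <-] [An _]]] : (y @` setT) `&` (A `&` A') !=set0.
    apply: clb => //; exists 0%N => // n _; by exists n.
  have [_ [[m /= lt_nm <-] [_ A'm]]] :
      (y @` [set m | (n < m)%N]) `&` (A `&` A') !=set0.
    apply: clb => //; exists n.+1 => // m lt_nm; by exists m.
  have := AA' (y n, y m); apply => //=.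
  suff -> : a^-1 * (x0 * y m * (y n)^-1) = y (m - n.+1)%N by exact: Kax.
  have aXN0 : a ^+ n != 0 by rewrite expf_neq0.
  rewrite /y -{1}(subnKC lt_nm) exprD exprS invfM.
  by field; apply/and3P.
have y0 : y @ \oo --> (0 : F).
  apply: (compact_cluster_set1 hF Kc nK).
    by exists 0%N => // n _; exact: Kax.
  apply/seteqP; split=> [b /ycl//|_ ->].
  have [|b [_ clb]] := Kc (y @ \oo) _.
    by exists 0%N => // n _; exact: Kax.
  by rewrite -(ycl b clb).
exists a => //.
rewrite (_ : (fun n => a ^+ n) = (fun z => z * x0^-1) \o y).
  rewrite -[X in _ --> X](mul0r x0^-1); apply: continuous_cvg => //.
  by apply: continuous_mul; [exact: continuous_id|exact: cst_continuous].
by apply/funext => n /=; rewrite /y mulfK.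
Qed.

End LocalField.

(** Inverses of small nonzero z are large: 1 / (z^-1 - x) = z / (1 - z x) tends
    to 0 with z. *)
Lemma exists_far (F : topologicalFieldType) (B : set F) (ts : seq F) :
  local_field F -> nbhs (0 : F) B ->
  exists t, {in ts, forall x, t - x != 0 /\ B (t - x)^-1}.
Proof.
move=> F_local nB.
have nz x : \forall z \near (0 : F), 1 - z * x != 0 /\ B (z * (1 - z * x)^-1).
  have dc : continuous (fun z : F => 1 - z * x).
    apply: continuous_sub; first exact: cst_continuous.
    by apply: continuous_mul; [exact: continuous_id|exact: cst_continuous].
  apply: filterI.
    have := dc 0 (fun z => z != 0); rewrite /= mul0r subr0; apply.
    by apply: nbhs_neq => //; exact: oner_neq0.
  have : {for 0, continuous (fun z : F => z * (1 - z * x)^-1)}.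
    apply: (@continuous2_cvg _ _ _ _ _ (nbhs_filter (0 : F)) id
      (fun z : F => (1 - z * x)^-1) *%R).
    - exact: (@field_mul_continuous F (0, (1 - 0 * x)^-1)).
    - exact: cvg_id.
    - apply: (@continuous_comp _ _ _ (fun z : F => 1 - z * x) (@GRing.inv F)).
        exact: dc.
      by apply: field_inv_continuous; rewrite mul0r subr0 oner_neq0.
  by move=> /(_ B); rewrite /= mul0r; apply.
have nall : \forall z \near (0 : F),
    {in ts, forall x, 1 - z * x != 0 /\ B (z * (1 - z * x)^-1)}.
  elim: ts => [|x ts IH]; first by apply: filterE => z x.
  apply: filterS2 (nz x) IH => z zx zts y.
  by rewrite inE => /predU1P[->//|/zts].
have [z z0 zP] := nbhs0_neq0 F_local nall.
exists z^-1 => x /zP[zx0 Bz].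
have -> : z^-1 - x = (1 - z * x) * z^-1.
  by rewrite mulrBl mul1r mulrAC divff // mul1r.
split; first by rewrite mulf_neq0 ?invr_neq0.
by rewrite invfM invrK mulrC.
Qed.

Lemma usual_space_locally_compact (F : topologicalFieldType) (V : vectType F) :
  local_field F -> locally_compact [set: usual_space V].
Proof.
move=> F_local v _.
have /choice[C CP] : forall j : 'I_(\dim {:V}), exists C : set F,
    [/\ nbhs (coord (vbasis {:V}) j v) C, compact C & closed C].
  by move=> j; apply: locally_compact_nbhs; exact: local_field_locally_compact.
pose B := [set w : usual_space V | forall j, C j (coord (vbasis {:V}) j w)].
exists B.
  have nB : nbhs v B.
    apply: (@filter_forall _ _ (fun j w => C j (coord (vbasis {:V}) j w)) _
      (nbhs_filter v)) => j.
    by have [nC _ _] := CP j; exact: (@continuous_coord F V j v _ nC).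
  by apply: filterS nB => w Bw _.
split.
  pose f (g : prod_topology (fun _ : 'I_(\dim {:V}) => F)) : usual_space V :=
    vecof (vbasis {:V}) (\row_j g j).
  have coordf j g : coord (vbasis {:V}) j (f g) = g j.
    by rewrite coord_vecof ?mxE //; exact: vbasisP.
  have -> : B = f @` [set g | forall j, C j (g j)].
    apply/seteqP; split=> [w Bw|_ [g Cg <-] j]; last by rewrite coordf.
    exists (fun j => coord (vbasis {:V}) j w) => //.
    rewrite /f -[RHS](rVofK (vbasisP {:V}) w).
    by congr vecof; apply/rowP => j; rewrite !mxE.
  apply: (@continuous_compact (prod_topology (fun _ : 'I_(\dim {:V}) => F))
    (usual_space V) f); last first.
    by apply: (@tychonoff _ (fun=> F)) => j; have [] := CP j.
  apply: continuous_subspaceT; apply: continuous_usual_space => j.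
  rewrite (_ : (fun g => _) = (fun g : prod_topology (fun=> F) => g j)).
    exact: (@proj_continuous _ (fun=> F) j).
  by apply/funext => g; rewrite coordf.
rewrite (_ : B = \bigcap_j [set w : usual_space V |
    C j (coord (vbasis {:V}) j w)]).
  apply: closed_bigI => j _.
  apply: (@preimage_closed _ _ (fun w : usual_space V =>
    coord (vbasis {:V}) j w : F)); last by have [] := CP j.
  by move=> w _; exact: continuous_coord.
by apply/seteqP; split=> w Bw j; [move=> _; exact: Bw|exact: (Bw j I)].
Qed.

(** * Quadratic forms *)

Section QuadraticForm.
Context (F : fieldType) (V : vectType F) (Q : V -> F).
Context (Q_quad : quadratic_form Q).

Definition polar (x y : V) : F := Q (x + y) - Q x - Q y.

Lemma quadratic_formD x y : Q (x + y) = Q x + Q y + polar x y.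
Proof. by rewrite /polar; ring. Qed.

Lemma polarC x y : polar x y = polar y x.
Proof. by rewrite /polar addrAC [x + y]addrC. Qed.

Lemma polarZr a x y : polar x (a *: y) = a * polar x y.
Proof.
have lin := quadratic_form_linearr Q_quad x.
have := lin a y 0; have := lin 1 0 0.
rewrite !scale1r !addr0 => /eqP; rewrite !mul1r -subr_eq subrr => /eqP <-.
by rewrite addr0.
Qed.

Lemma polar_sumr x (I : Type) (s : seq I) (a : I -> F) (y : I -> V) :
  polar x (\sum_(i <- s) a i *: y i) = \sum_(i <- s) a i * polar x (y i).
Proof.
have lin := quadratic_form_linearr Q_quad x.
elim: s => [|i s IH]; first by rewrite !big_nil -[0](scale0r 0) polarZr mul0r.
by rewrite !big_cons -IH; exact: lin.
Qed.

Lemma polarxx x : polar x x = 2%:R * Q x.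
Proof.
rewrite /polar -mulr2n -scaler_nat (quadratic_formZ Q_quad); ring.
Qed.

End QuadraticForm.

(** Q (v) is half the polar form at (v, v), a polynomial in the coordinates. *)
Lemma quadratic_form_continuous (F : topologicalFieldType) (V : vectType F)
    (Q : V -> F) :
  2%:R != 0 :> F -> quadratic_form Q ->
  continuous (Q : usual_space V -> F).
Proof.
move=> two0 Q_quad; pose e := vbasis {:V}.
rewrite (_ : (Q : usual_space V -> F) = (fun v : usual_space V => 2%:R^-1 *
    \sum_i coord e i v * \sum_j coord e j v * polar Q e`_i e`_j)).
  apply: continuous_mul; first exact: cst_continuous.
  apply: continuous_sum => i.
  apply: continuous_mul; first exact: continuous_coord.
  apply: continuous_sum => j.
  apply: continuous_mul; first exact: continuous_coord.
  exact: cst_continuous.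
apply/funext => v.
transitivity (2%:R^-1 * polar Q v v); first by rewrite polarxx // mulKf.
have polarE x y : polar Q x y = \sum_j coord e j y * polar Q x e`_j.
  by rewrite {1}(coord_vbasis (memvf y)) polar_sumr.
by congr (_ * _); rewrite polarE; apply: eq_bigr => i _; rewrite polarC polarE.
Qed.

(** A hyperbolic pair: u is isotropic, z pairs to 1 with u by nondegeneracy, and
    subtracting Q z times u from z makes it isotropic without changing the
    pairing. *)
Lemma isotropic_hyperbolic (F : fieldType) (V : vectType F) (Q : V -> F) :
  quadratic_form Q -> nondegenerate_form Q -> isotropic Q ->
  exists u w : V, forall t, t != 0 -> Q (t *: u + t^-1 *: w) = 1.
Proof.
move=> Q_quad Q_nondeg [u u0 Qu].
have [y uy0] : exists y, polar Q u y != 0.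
  apply: contrapT => none; move/eqP: u0; apply; apply: Q_nondeg => y.
  have -> : associated_form Q u y = 2%:R^-1 * polar Q u y by [].
  have [->|ne] := eqVneq (polar Q u y) 0; first by rewrite mulr0.
  by case: none; exists y.
pose z := (polar Q u y)^-1 *: y.
have uz : polar Q u z = 1 by rewrite polarZr // mulVf.
pose w := z + (- Q z) *: u.
have uw : polar Q u w = 1.
  have uzw : polar Q u (- Q z *: u + z) = - Q z * polar Q u u + polar Q u z.
    exact: (quadratic_form_linearr Q_quad u (- Q z) u z).
  by rewrite /w addrC uzw polarxx // Qu !mulr0 add0r.
have Qw : Q w = 0.
  rewrite quadratic_formD polarZr // polarC uz (quadratic_formZ Q_quad _ u) Qu.
  by rewrite mulr0 mulr1 addr0 subrr.
exists u, w => t t0.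
rewrite quadratic_formD !(quadratic_formZ Q_quad) Qu Qw !mulr0 !add0r.
by rewrite polarZr // polarC polarZr // polarC uw mulr1 mulVf.
Qed.

(** * Compactness of the unit sphere of an anisotropic form *)

(** If Q v = 1 and n > 0 is the first exponent with a^n v in the interior of C,
    then a^n v is in the compact set shell, where Q omits a neighbourhood of 0.
    As Q (a^n v) = a^(2n) tends to 0, n is bounded and v lies in one of
    finitely many dilates of C. *)
Theorem anisotropic_sphere_compact (F : topologicalFieldType) (V : vectType F)
    (Q : V -> F) :
  local_field F -> 2%:R != 0 :> F -> quadratic_form Q -> anisotropic Q ->
  compact [set v : usual_space V | Q v = 1].
Proof.
move=> F_local two0 Q_quad Q_an.
have Qc := quadratic_form_continuous two0 Q_quad.
have [a a0 acvg] := exists_contracting F_local.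
have [C [nC Cc Ccl]] :=
  locally_compact_nbhs (0 : usual_space V)
    (usual_space_locally_compact F_local).
have scale_cont b :
    continuous (fun v : usual_space V => b *: v : usual_space V).
  by apply: continuous_scale; [exact: cst_continuous|exact: continuous_id].
pose shell := C `&` ~` [set v : usual_space V | C° (a^-1 *: v)].
have shellc : compact shell.
  apply: compact_closedI => //; apply: open_closedC.
  have /continuousP := scale_cont a^-1; apply; exact: open_interior.
have Qshell_cl : closed (Q @` shell).
  apply: compact_closed; first exact: local_field_hausdorff F_local.
  apply: (@continuous_compact (usual_space V) F Q) => //.
  exact: continuous_subspaceT.
have Qshell0 : ~ (Q @` shell) 0.
  move=> [v [_ nCv] Qv]; apply: nCv; suff -> : v = 0 by rewrite /= scaler0.
  by apply: contrapT => /eqP v0; apply: Q_an; exists v.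
have [n0 _ n0P] : \forall n \near \oo, (~` (Q @` shell)) (a ^+ n * a ^+ n).
  have : (fun x : F => x * x) \o (fun n => a ^+ n) @ \oo --> (0 : F).
    rewrite -[X in _ --> X](mulr0 (0 : F)).
    apply: (@continuous_cvg _ _ _ _ _ _ (fun x : F => x * x)) => //.
    by apply: continuous_mul; exact: continuous_id.
  by apply; apply: open_nbhs_nbhs; split=> //; exact: closed_openC.
have absorb (v : usual_space V) : exists n, `[< C° (a ^+ n *: v) >].
  have : (fun x : F => x *: v : usual_space V) \o (fun n => a ^+ n) @ \oo
      --> (0 : usual_space V).
    rewrite -[X in _ --> X](scale0r v).
    apply: (@continuous_cvg _ _ _ _ _ _
      (fun x : F => x *: v : usual_space V)) => //.
    by apply: continuous_scale; [exact: continuous_id|exact: cst_continuous].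
  move=> /(_ C°) [].
    by apply: open_nbhs_nbhs; split=> //; exact: open_interior.
  by move=> n _ nP; exists n; apply/asboolP; apply: (nP n) => /=.
pose D n := (fun v : usual_space V => (a ^+ n)^-1 *: v : usual_space V) @` C.
apply: (@subclosed_compact _ _ (\big[setU/set0]_(n < n0.+1) D n)).
- apply: (@preimage_closed _ _ (Q : usual_space V -> F) [set 1]).
    by move=> v _; exact: Qc.
  exact: local_field_closed1.
- apply: bigsetU_compact => n _; apply: continuous_compact => //.
  exact: continuous_subspaceT.
- move=> v /= Qv; rewrite -(bigcup_mkord _ D).
  case: (ex_minnP (absorb v)) => n /asboolP/interior_subset Cn nmin.
  have aXN0 : a ^+ n != 0 by rewrite expf_neq0.
  suff len : (n < n0.+1)%N.
    by exists n => //; exists (a ^+ n *: v); rewrite // scalerA mulVf ?scale1r.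
  case: n Cn nmin aXN0 => [//|n] Cn nmin aXN0.
  rewrite ltnNge; apply/negP => len.
  apply: (n0P n.+1); first exact: ltnW.
  exists (a ^+ n.+1 *: v); last by rewrite (quadratic_formZ Q_quad) Qv mulr1.
  split=> //= /asboolP; rewrite scalerA exprS mulrA mulVf // mul1r.
  by move=> /nmin; rewrite ltnn.
Qed.

(** * Isotropic forms *)

(** By induction on n there are translations t_1, .., t_n along u and a nonempty
    open set G whose translates by the t_i u lie in open sets O of pairwise
    distinct colours.  For n greater than the number of colours this is
    absurd. *)
Theorem isotropic_no_open_coloring (F : topologicalFieldType) (V : vectType F)
    (Q : V -> F) (u w : V) N (O : 'I_N -> set (usual_space V)) :
  local_field F ->
  (forall t, t != 0 -> Q (t *: u + t^-1 *: w) = 1) ->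
  (forall i, open (O i)) ->
  (forall i (x y : usual_space V), O i x -> O i y -> Q (x - y) <> 1) ->
  ~ dense (\bigcup_i O i).
Proof.
move=> F_local Quw Oo Oi Od.
have conf n : exists (s : seq (F * 'I_N)) (G : set (usual_space V)),
    [/\ size s = n, uniq (map snd s), open G, G !=set0 &
    {in s, forall p, forall g : usual_space V, G g -> O p.2 (g + p.1 *: u)}].
  elim: n => [|n [s [G [ss us Go [g0 Gg0] sO]]]].
    by exists [::], setT; split=> //; [exact: openT|exists 0].
  have sub_cont : continuous (fun p : usual_space V * F =>
      p.1 - p.2 *: w : usual_space V).
    apply: continuous_sub; first by move=> p; exact: cvg_fst.
    apply: continuous_scale; first by move=> p; exact: cvg_snd.
    exact: cst_continuous.
  have := sub_cont (g0, 0) G; rewrite /= scale0r subr0.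
  move=> -[|[A B] /= [nA nB] AB]; first exact: open_nbhs_nbhs.
  have [t tP] := exists_far (map fst s) F_local nB.
  pose G' := G `&` A°.
  have [||z [G'z [c _ Oz]]] := Od [set z : usual_space V | G' (z - t *: u)].
  - by exists (g0 + t *: u); rewrite /= addrK; split.
  - by apply: open_shift; apply: openI => //; exact: open_interior.
  exists ((t, c) :: s),
    (G' `&` [set g : usual_space V | O c (g - - (t *: u))]); split.
  - by rewrite /= ss.
  - rewrite /= us andbT; apply/negP => /mapP[p ps cp].
    (* With b = (t - p.1)^-1, the point z - t u - b w is still in G, so its
       translate by p.1 u has colour c, and it is joined to z. *)
    have [tp0 Bt] := tP _ (map_f fst ps).
    have [_ /interior_subset Az] := G'z.
    have Gz := AB (z - t *: u, (t - p.1)^-1) (conj Az Bt).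
    have := sO _ ps _ Gz; rewrite -cp => Oz'.
    apply: (Oi c _ _ Oz Oz'); rewrite -[RHS](Quw _ tp0); congr Q.
    rewrite /= scalerBl opprD !opprB [_ + (t *: u - z)]addrC !addrA.
    by rewrite [z + t *: u]addrC addrK addrAC.
  - apply: openI; last exact: open_shift.
    by apply: openI => //; exact: open_interior.
  - by exists (z - t *: u); split=> //=; rewrite opprK subrK.
  - move=> p; rewrite inE => /predU1P[->|ps] g [[Gg _] Og] /=.
      by move: Og; rewrite /= opprK.
    exact: sO.
have [s [G [ss us _ _ _]]] := conf N.+1.
have : (size (map snd s) <= #|'I_N|)%N by rewrite -(card_uniqP us) max_card.
by rewrite size_map ss card_ord ltnn.
Qed.

(** * Finite Borel chromatic numbers *)

Lemma borel_setC (T : topologicalType) (A : set T) :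
  borel_set A -> borel_set (~` A).
Proof. by move=> Ab; rewrite -setTD; exact: sigma_algebraCD. Qed.

Lemma borel_setD (T : topologicalType) (A B : set T) :
  borel_set A -> borel_set B -> borel_set (A `\` B).
Proof.
move=> Ab Bb; rewrite (_ : A `\` B = ~` (\bigcup_n bigcup2 (~` A) B n)).
  apply: borel_setC; apply: (@sigma_algebra_bigcup T setT open) => -[|[|n]] /=.
  - exact: borel_setC.
  - exact: Bb.
  - exact: sigma_algebra0.
by rewrite bigcup2E setCU setCK.
Qed.

(** Each point gets the first index of a set containing it, so a colour class is
    a difference of two open sets. *)
Lemma open_cover_borel_coloring (T : topologicalType) (adj : T -> T -> Prop) N
    (A : 'I_N -> set T) :
  (forall i, open (A i)) ->
  (forall i x y, A i x -> A i y -> ~ adj x y) ->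
  (forall x, exists i, A i x) ->
  exists c : T -> 'I_N, (forall i, borel_set (c @^-1` [set i])) /\
    forall x y, adj x y -> c x <> c y.
Proof.
move=> Ao Ai Acov.
have /choice[c cP] : forall x, exists i, A i x /\
    forall j : 'I_N, A j x -> (i <= j)%N.
  move=> x; have [i0 Ai0] := Acov x.
  have i0P : `[< A i0 x >] by apply/asboolP.
  case: (@arg_minnP _ i0 (fun i => `[< A i x >]) (@nat_of_ord N) i0P).
  move=> i /asboolP.
  by move=> Aix imin; exists i; split=> // j /asboolP/imin.
exists c; split; last first.
  move=> x y xy cxy.
  by apply: (Ai (c x) x y) => //; [|rewrite cxy]; exact: (cP _).1.
move=> i.
rewrite (_ : _ @^-1` _ = A i `\` \bigcup_(j in [set j : 'I_N | (j < i)%N]) A j).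
  apply: borel_setD; apply: sub_sigma_algebra => //.
  exact: bigcup_open.
apply/seteqP; split=> x /=.
  move=> <-; have [Ax xmin] := cP x; split=> // -[j /= ltj /xmin].
  by rewrite leqNgt ltj.
move=> [Aix nA]; have [Ax xmin] := cP x; apply/val_inj/eqP.
rewrite eqn_leq xmin //= leqNgt; apply/negP => lt; apply: nA.
by exists (c x).
Qed.

(** A colouring indexed by a finite set may have empty classes, whereas a
    partition may not; the least size of a finite Borel partition into
    independent sets is then the chromatic number. *)
Lemma finite_borel_chromatic_numberP (T : topologicalType)
    (adj : T -> T -> Prop) :
  (exists n : nat, @borel_chromatic_number T adj nat `I_n) <->
  exists N (c : T -> 'I_N), (forall i, borel_set (c @^-1` [set i])) /\
    forall x y, adj x y -> c x <> c y.
Proof.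
split.
  move=> [n [[P [[Pcov Ptriv _] PB] Pn] _]].
  have /choice[cl clP] : forall x : T, exists A, P A /\ A x.
    by move=> x; have : [set: T] x by []; rewrite -Pcov => -[A PA Ax]; exists A.
  have clE A x : P A -> A x -> cl x = A.
    move=> PA Ax; have [Pcl clx] := clP x.
    by apply: (Ptriv (cl x) A) => //; exists x.
  have [f] : $|{injfun P >-> `I_n}|.
    by apply/pcard_leP; move: Pn; rewrite card_eq_le => /andP[].
  have fP A : P A -> (f A < n)%N by move=> PA; exact: (@funS _ _ _ _ f A PA).
  have finj A A' : P A -> P A' -> f A = f A' -> A = A'.
    by move=> PA PA'; apply: (@inj _ _ P f); rewrite inE.
  exists n, (fun x => Ordinal (fP _ (clP x).1)); split.
    move=> i; have [[A [PA fA]]|none] := pselect (exists A, P A /\ f A = i).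
      rewrite (_ : _ @^-1` _ = A); first exact: (PB A PA).1.
      apply/seteqP; split=> x /=.
        move=> fx; have <- : cl x = A.
          apply: (finj _ _ (clP x).1 PA).
          by rewrite fA -fx.
        exact: (clP x).2.
      by move=> Ax; apply/val_inj; rewrite /= (clE A).
    rewrite (_ : _ @^-1` _ = set0); first exact: sigma_algebra0.
    rewrite -subset0 => x /= fx; apply: none; exists (cl x).
    by split; [exact: (clP x).1|rewrite -fx].
  move=> x y xy [fxy]; have clxy : cl x = cl y.
    exact: (finj _ _ (clP x).1 (clP y).1).
  have [Pclx clx] := clP x; apply: ((PB _ Pclx).2 x y) => //.
  by rewrite clxy; exact: (clP y).2.
move=> [N [c [cB cadj]]].
pose P := [set c @^-1` [set i] | i in [set i | c @^-1` [set i] !=set0]].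
have Pcol : borel_coloring adj P.
  split; first split.
  - apply/seteqP; split=> // x _; exists (c @^-1` [set c x]) => //.
    by exists (c x) => //; exists x.
  - by move=> _ _ [i _ <-] [j _ <-] [x [/= <- <-]].
  - by move=> _ [i ine <-].
  - move=> _ [i _ <-]; split; first exact: cB.
    by move=> x y /= cx cy /cadj; rewrite cx cy.
have Pfin : finite_set P by apply: finite_image; exact: finite_finset.
have exn : exists n,
    `[< exists2 P', borel_coloring adj P' & (P' #= `I_n)%card >].
  by have /finite_setP[n Pn] := Pfin; exists n; apply/asboolP; exists P.
case: (ex_minnP exn) => n /asboolP ncol nmin; exists n; split=> // P' P'col.
have [/finite_setP[m P'm]|/infiniteP natP'] := pselect (finite_set P').
  rewrite (card_le_eqr P'm) card_le_II; apply: nmin.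
  by apply/asboolP; exists P'.
by apply: card_le_trans natP'; exact: subset_card_le.
Qed.

Theorem theorem1p1 (F : topologicalFieldType) (F_local : local_field F)
    (F_char0 : [pchar F] =i pred0) (V : vectType F)
    (dimV : (2 <= \dim {:V})%N) (Q : V -> F) (Q_quad : quadratic_form Q)
    (Q_nondeg : nondegenerate_form Q) :
  (exists n : nat,
     @borel_chromatic_number (usual_space V) (quadratic_graph Q) nat `I_n) <->
  anisotropic Q.
Proof.
have two0 : 2%:R != 0 :> F.
  by apply/negP => two0; have := F_char0 2%N; rewrite !inE two0.
have Vlc : locally_compact [set: usual_space V].
  exact: usual_space_locally_compact.
rewrite finite_borel_chromatic_numberP; split.
  move=> [N [c [cB cadj]]] /(isotropic_hyperbolic Q_quad Q_nondeg)[u [w Quw]].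
  have [O [Oo Oi Od]] :=
    @borel_coloring_dense_open (usual_space V) [set v | Q v = 1] N c
      Vlc cB cadj.
  exact: (isotropic_no_open_coloring F_local Quw Oo Oi Od).
move=> Q_an.
have Q0 : Q 0 = 0.
  by rewrite -(scale0r (0 : V)) (quadratic_formZ Q_quad) expr0n mul0r.
have [||N [A [Ao Ai Acov]]] :=
    @compact_cayley_open_cover (usual_space V) [set v | Q v = 1] Vlc
      (anisotropic_sphere_compact F_local two0 Q_quad Q_an).
- apply: (@preimage_closed _ _ (Q : usual_space V -> F) [set 1]).
    by move=> v _; exact: quadratic_form_continuous.
  exact: local_field_closed1.
- by rewrite /= Q0 => /esym/eqP; rewrite oner_eq0.
by exists N; exact: (open_cover_borel_coloring Ao Ai Acov).
Qed.
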